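(* Let $k\ge 3$ and $t\ge 10^7 k^6$ be integers, and suppose that $k$ is the smallest integer greater than $2$ that does not divide $t$. Then for every $\eta>0$ and every integer $\ell$ there exists an integer $n_1=n_1(\eta,\ell)$ such that every oriented graph $G$ on $n\ge n_1$ vertices with minimum semidegree $\delta^0(G)\ge (1+\eta)n/k$ contains (as a subgraph) every oriented cycle $C$ of length $\ell$ with cycle-type $t(C)=t$.
   Context: An oriented graph is a directed graph obtained from a simple undirected graph by giving each edge a direction (no loops, at most one edge between any two vertices). The minimum semidegree $\delta^0(G)$ is the minimum of the minimum outdegree and the minimum indegree of $G$. An oriented cycle is a cycle whose edges are given arbitrary orientations. The cycle-type $t(C)$ of an oriented cycle $C$ is the absolute value of the difference between the number of edges oriented clockwise and the number of edges oriented anticlockwise (when traversing the cycle in a fixed cyclic order). If no oriented cycle of length $\ell$ has cycle-type $t$, the statement is vacuous. *)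

(* Defs.v *)
From HB Require Import structures.
From mathcomp Require Import all_boot all_order all_algebra.
From mathcomp Require Import reals.

Set Implicit Arguments.
Unset Strict Implicit.
Unset Printing Implicit Defensive.

Import Order.TTheory GRing.Theory Num.Theory.

(* Asymmetry rules out both loops (take x = y) and pairs of opposite arcs. *)
Record ograph := OGraph {
  vertex :> finType;
  arc : rel vertex;
  arc_asym : forall x y : vertex, arc x y -> ~~ arc y x
}.

Arguments arc {o} x y : rename.

Definition adjacent (G : ograph) (x y : G) : bool := arc x y || arc y x.

Definition outdegree (G : ograph) (x : G) : nat := #|[set y : G | arc x y]|.

Definition indegree (G : ograph) (x : G) : nat := #|[set y : G | arc y x]|.

(* Every degree is less than #|G|, so the default value #|G| only matters for
   the graph without vertices, whose minimum degrees are then 0. *)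
Definition min_outdegree (G : ograph) : nat :=
  \big[minn/#|G|]_(x : G) outdegree x.

Definition min_indegree (G : ograph) : nat :=
  \big[minn/#|G|]_(x : G) indegree x.

Definition min_semidegree (G : ograph) : nat :=
  minn (min_outdegree G) (min_indegree G).

(* H is a (not necessarily induced) subgraph of G, up to isomorphism. *)
Definition contains (G H : ograph) : Prop :=
  exists f : H -> G,
    injective f /\ forall x y : H, arc x y -> arc (f x) (f y).

(* C is an oriented cycle of length l whose vertices, in cyclic order, are
   c 0, ..., c (l - 1); ordS i is i + 1 modulo l. The underlying undirected
   graph is exactly this cycle, and the orientations are arbitrary. *)
Definition oriented_cycle (C : ograph) (l : nat) (c : 'I_l -> C) : Prop :=
  [/\ 3 <= l,
      bijective c
    & forall x y : C, adjacent x y <->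
        exists i : 'I_l, (x = c i /\ y = c (ordS i)) \/
                         (x = c (ordS i) /\ y = c i)].

(* The absolute value makes this independent of the traversal c. *)
Definition cycle_type (C : ograph) (l : nat) (c : 'I_l -> C) : nat :=
  let forward := #|[set i : 'I_l | arc (c i) (c (ordS i))]| in
  let backward := #|[set i : 'I_l | arc (c (ordS i)) (c i)]| in
  `|(forward%:Z - backward%:Z)%R|%N.

(* Main.v *)
(** An oriented cycle of type t folds onto the directed cycle of length t, so it
    is enough to find a directed closed walk of length t that occurs in G with
    positive density: by supersaturation such a walk has a blow-up in G.

    Every oriented graph with minimum semidegree greater than n/k has a closed
    walk of length t.  By comparing the sizes of balls at different scales one
    finds a vertex z to which all vertices near z return within O(k^3) steps.  Let
    g be the gcd of the lengths of the short closed walks at z; all large multiples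
    of g are lengths of closed walks at z.  The sets of vertices reached from z in
    1, ..., g steps are disjoint and have more than n/k vertices each, so g < k.  A
    bipartite oriented graph has at most n^2/4 arcs, so g = 2 forces k > 4.  Hence
    g divides t in all cases.

    Density comes from sampling a bounded number m of vertices independently:
    Chebyshev's inequality shows that in half of the samples all but boundedly
    many vertices keep their relative degrees, and the slack eta absorbs the
    deletion of the others.  Hence a fixed closed walk on the m sampled indices is
    present in a positive proportion of the samples. *)

Require Import Defs.
From mathcomp Require Import all_boot all_order all_algebra.
From mathcomp Require Import reals.
From mathcomp Require Import zify ring lra.
(* Otherwise [arc] would be [path.arc]. *)
Import Defs.

Set Implicit Arguments.
Unset Strict Implicit.
Unset Printing Implicit Defensive.

Import Order.TTheory GRing.Theory Num.Theory.

(** * Counting tools *)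

Lemma card_set_sum (X : finType) (P : pred X) : #|[set x | P x]| = \sum_x P x.
Proof.
rewrite -sum1_card (eq_bigl _ _ (fun x => in_set _ x)) big_mkcond.
by apply: eq_bigr => x _; case: (P x).
Qed.

Lemma double_count (X Y : finType) (A : {set X}) (B : {set Y})
    (P : X -> Y -> bool) :
  \sum_(x in A) #|[set y in B | P x y]| = \sum_(y in B) #|[set x in A | P x y]|.
Proof.
transitivity (\sum_(x in A) \sum_(y in B) P x y).
  apply: eq_bigr => x _; rewrite -sum1_card.
  by rewrite (eq_bigl _ _ (fun y => in_set _ y)) big_mkcondr.
rewrite exchange_big; apply: eq_bigr => y _; rewrite -sum1_card.
by rewrite (eq_bigl _ _ (fun x => in_set _ x)) big_mkcondr.
Qed.

Lemma pigeonhole (X Y : finType) (A : {set X}) (B : {set Y})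
    (P : X -> Y -> bool) :
  0 < #|A| -> (forall x, x \in A -> exists2 y, y \in B & P x y) ->
  exists2 y, y \in B & #|A| <= #|B| * #|[set x in A | P x y]|.
Proof.
move=> A0 PAB; apply/exists_inP; rewrite -[[exists _ in _, _]]negbK.
rewrite negb_exists_in; apply/negP => /forall_inP small.
have B0 : 0 < #|B|.
  have [x xA] := card_gt0P A0; have [y yB _] := PAB x xA.
  by apply/card_gt0P; exists y.
have : \sum_(y in B) (#|B| * #|[set x in A | P x y]|).+1 <= #|B| * #|A|.
  by rewrite -sum_nat_const; apply: leq_sum => y /small; rewrite -ltnNge.
apply/negP; rewrite -ltnNge.
apply: (@leq_trans (\sum_(y in B) #|B| * #|[set x in A | P x y]|).+1).
  rewrite ltnS -big_distrr -double_count leq_mul2l; apply/orP; right.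
  rewrite -sum1_card; apply: leq_sum => x /PAB[y yB Pxy].
  by apply/card_gt0P; exists y; rewrite inE yB.
under [leqRHS]eq_bigr do rewrite -addn1.
by rewrite big_split /= sum1_card -addn1 leq_add2l.
Qed.

(** For [n > 0], as fractions of [n], each size exceeds the square root of the previous one, so the
    lower bounds are 1/4, 1/2, 2^(-1/2) and 2^(-1/4), and the last is above 3/4. *)
Lemma square_growth n b1 b2 b3 b4 : n < 4 * b1 ->
  b1 * n < b2 ^ 2 -> b2 * n < b3 ^ 2 -> b3 * n < b4 ^ 2 -> 3 * n < 4 * b4.
Proof.
rewrite -!mulnn => h1 h2 h3 h4.
have [->|n0] := posnP n; first by nia.
have h2' : n < 2 * b2.
  rewrite ltnNge; apply/negP => h.
  have := leq_mul h h; nia.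
have h3' : n * n < 2 * (b3 * b3) by nia.
rewrite ltnNge; apply/negP => h.
have h5 : 16 * b3 < 9 * n by have := leq_mul h h; nia.
have := leq_mul (ltnW h5) (ltnW h5); nia.
Qed.

(** * Walks and balls in a digraph *)

Section ShortWalks.
Variables (T : finType) (e : rel T).

Definition step (A : {set T}) : {set T} := [set y | [exists x in A, e x y]].

Definition reach (i : nat) (x : T) : {set T} := iter i step [set x].

Definition ball (r : nat) (x : T) : {set T} := \bigcup_(i < r.+1) reach i x.

Lemma reach0 x y : (y \in reach 0 x) = (y == x).
Proof. by rewrite inE. Qed.

Lemma reachS i x y :
  reflect (exists2 u, u \in reach i x & e u y) (y \in reach i.+1 x).
Proof. by rewrite inE; apply: exists_inP. Qed.

Lemma reach1 x y : (y \in reach 1 x) = e x y.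
Proof.
apply/reachS/idP => [[u]|exy]; first by rewrite reach0 => /eqP->.
by exists x; rewrite ?reach0.
Qed.

Lemma reachD i j x y z :
  y \in reach i x -> z \in reach j y -> z \in reach (i + j) x.
Proof.
move=> xy; elim: j z => [|j IHj] z; first by rewrite reach0 addn0 => /eqP->.
by case/reachS=> u /IHj xu uz; rewrite addnS; apply/reachS; exists u.
Qed.

Lemma ballP r x y :
  reflect (exists2 i, i <= r & y \in reach i x) (y \in ball r x).
Proof.
apply: (iffP bigcupP) => [[i _ yi]|[i ir yi]].
  by exists i => //; rewrite -ltnS.
by have ir' : i < r.+1 by []; exists (Ordinal ir').
Qed.

Lemma ball_trans r s x y : y \in ball r x -> ball s y \subset ball (r + s) x.
Proof.
case/ballP=> i ir yi; apply/subsetP=> z /ballP[j js zj]; apply/ballP.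
by exists (i + j); [apply: leq_add|apply: reachD yi zj].
Qed.

Lemma ball_step r x y z : y \in ball r x -> e y z -> z \in ball r.+1 x.
Proof.
case/ballP=> i ir yi yz; apply/ballP; exists i.+1 => //.
by apply/reachS; exists y.
Qed.

Lemma reach_seq i x y : y \in reach i x ->
  exists w : nat -> T,
    [/\ w 0 = x, w i = y & forall j, j < i -> e (w j) (w j.+1)].
Proof.
elim: i y => [|i IHi] y.
  by rewrite reach0 => /eqP->; exists (fun=> x).
case/reachS=> u /IHi[w [w0 wi we]] uy.
exists (fun j => if j <= i then w j else y); split=> //; first by rewrite ltnn.
move=> j; rewrite ltnS => ji; rewrite ji; case: (ltnP j i) => [/we //|ij].
by have -> : j = i; [apply/eqP; rewrite eqn_leq ji|rewrite wi].
Qed.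

(** * Short returns under a semidegree condition *)

Section Degrees.
Variables (k : nat).
Hypothesis outdeg : forall x, #|T| < k * #|[set y | e x y]|.
Hypothesis indeg : forall x, #|T| < k * #|[set y | e y x]|.

Lemma card_reach i x : #|T| < k * #|reach i.+1 x|.
Proof.
elim: i => [|i IHi].
  apply: leq_trans (outdeg x) _; rewrite leq_mul2l; apply/orP; right.
  by apply/subset_leq_card/subsetP => y; rewrite inE reach1.
have: reach i.+1 x != set0.
  by apply: contraTneq IHi => ->; rewrite cards0 muln0.
case/set0Pn=> u xu; apply: leq_trans (outdeg u) _.
rewrite leq_mul2l; apply/orP; right.
by apply/subset_leq_card/subsetP => y; rewrite inE => uy; apply/reachS; exists u.
Qed.

(* A ball of nearly minimal growth is almost entirely reachable from each of
   its points near the centre, so those points all return to a vertex z of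
   large indegree from the ball. *)
Lemma returning_vertex s (x0 : T) : 2 <= s ->
  exists z r, r + s <= k ^ 2 * s /\
    forall y, y \in ball (s - 2) z ->
      exists2 j, 0 < j <= r.+1 & z \in reach j y.
Proof.
move=> s2; have k0 : 0 < k by rewrite lt0n; apply: contraTneq (outdeg x0) => ->.
pose xm r := [arg min_(x < x0) #|ball r x|].
pose f r := #|ball r (xm r)|.
have fmin r y : f r <= #|ball r y|.
  by rewrite /f /xm; case: arg_minnP => // x _; apply.
(* The least ball size [f] starts positive and never exceeds n, so it cannot gain n/k^2 at each of
   [k ^ 2] consecutive scales. *)
have [i ik fi] : exists2 i, i < k ^ 2 &
    k ^ 2 * f (i.+1 * s) < k ^ 2 * f (i * s) + #|T|.
  have [/exists_inP[i _ fi]|] := boolP [exists i in 'I_(k ^ 2),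
      k ^ 2 * f (i.+1 * s) < k ^ 2 * f (i * s) + #|T|]; first by exists i.
  rewrite negb_exists_in => /forall_inP fgrow.
  have grow i : i <= k ^ 2 -> k ^ 2 * f 0 + i * #|T| <= k ^ 2 * f (i * s).
    elim: i => [|i IHi] ik; first by rewrite mul0n addn0.
    have := fgrow (Ordinal ik) isT; rewrite -leqNgt; apply: leq_trans.
    by rewrite mulSn addnCA addnC leq_add2r; apply: IHi (ltnW ik).
  have f0 : 0 < f 0.
    rewrite /f card_gt0; apply/set0Pn; exists (xm 0); apply/ballP.
    by exists 0; rewrite ?reach0.
  have fT : f (k ^ 2 * s) <= #|T| by apply: max_card.
  have := grow _ (leqnn _); have : 0 < k ^ 2 by rewrite expn_gt0 k0.
  nia.
set r := i * s; set x := xm (i.+1 * s).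
have rs : i.+1 * s = r + s by rewrite /r mulSn addnC.
(* By averaging: [x] has more than n/k outneighbours, and each of them sends out more than n/k
   arcs. *)
have [z zin] : exists z, #|T| < k ^ 2 * #|[set u in reach 1 x | e u z]|.
  apply/existsP; rewrite -[[exists _, _]]negbK negb_exists.
  apply/negP => /forallP small.
  have : k ^ 2 * (\sum_(u in reach 1 x) #|[set z in [set: T] | e u z]|)
         <= #|T| * #|T|.
    rewrite double_count big_distrr /= -sum_nat_const.
    rewrite [leqRHS](eq_bigl (mem [set: T])) => [|u]; last by rewrite !inE.
    by apply: leq_sum => z _; rewrite leqNgt.
  have := card_reach 0 x.
  have : #|reach 1 x| * #|T| <=
         k * (\sum_(u in reach 1 x) #|[set z in [set: T] | e u z]|).
    rewrite big_distrr /= -sum_nat_const; apply: leq_sum => u _.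
    rewrite (_ : [set z in _ | _] = [set z | e u z]); first exact: ltnW.
    by apply/setP => z; rewrite !inE.
  set S := \sum_(_ in _) _; rewrite -mulnn.
  have : 0 < #|T| by apply/card_gt0P; exists x0.
  move=> n0 h1 h2 h3.
  have : k * (#|reach 1 x| * #|T|) <= k * (k * S) by rewrite leq_mul2l h1 orbT.
  have : #|T| * #|T| < (k * #|reach 1 x|) * #|T| by rewrite ltn_mul2r n0 h2.
  nia.
exists z, r; split; first by rewrite -rs leq_mul2r ik orbT.
move=> y yz.
have x1z : z \in ball 2 x.
  have : [set u in reach 1 x | e u z] != set0.
    by apply: contraTneq zin => ->; rewrite cards0 muln0.
  case/set0Pn=> u; rewrite inE => /andP[xu uz].
  by apply/ballP; exists 2 => //; apply/reachS; exists u.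
have yx : y \in ball s x.
  by rewrite -(subnKC s2); apply: subsetP yz; apply: ball_trans.
have yB : ball r y \subset ball (i.+1 * s) x.
  by rewrite rs addnC; apply: ball_trans.
have zB : [set u in reach 1 x | e u z] \subset ball (i.+1 * s) x.
  apply/subsetP => u; rewrite inE => /andP[xu _]; apply/ballP; exists 1 => //.
  by rewrite rs; lia.
(* Both sets lie in [ball (i.+1 * s) x], which has [f (i.+1 * s)] elements. The first has at least
   [f r] and the second more than n/k^2, so by the choice of [i] they meet. *)
have : ~~ [disjoint ball r y & [set u in reach 1 x | e u z]].
  apply/negP => dis.
  have : #|ball r y :|: [set u in reach 1 x | e u z]| <= #|ball (i.+1 * s) x|.
    by apply: subset_leq_card; rewrite subUset yB.
  rewrite cardsU (disjoint_setI0 dis) cards0 subn0 => le_sum.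
  have: k ^ 2 * (f r + #|[set u in reach 1 x | e u z]|) <= k ^ 2 * f (i.+1 * s).
    rewrite leq_mul2l; apply/orP; right; apply: leq_trans le_sum.
    by rewrite leq_add2r fmin.
  rewrite mulnDr leqNgt; case/negP; apply: leq_trans fi _.
  by rewrite leq_add2l ltnW.
rewrite -setI_eq0 => /set0Pn[u]; rewrite !inE => /andP[/ballP[j jr uj]].
by case/andP=> _ uz; exists j.+1 => //; apply/reachS; exists u.
Qed.

(** * The period of the short closed walks at a vertex *)

Section Phases.
Variables (z : T) (s g : nat).
Hypothesis phase : forall i j y, i <= s -> j <= s ->
  y \in reach i z -> y \in reach j z -> i = j %[mod g].

(** If [k <= g], the lengths 1, ..., k are distinct modulo [g], so the sets reached from [z] in
    these numbers of steps are disjoint. Each has more than n/k vertices, which is too many in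
    total. *)
Lemma period_lt : k <= s -> g < k.
Proof.
move=> ks; rewrite ltnNge; apply/negP => kg.
have : \sum_(i in [set: 'I_k]) #|[set y in [set: T] | y \in reach i.+1 z]| <= #|T|.
  rewrite double_count -cardsT -sum1_card; apply: leq_sum => y _.
  apply/card_le1P => i; rewrite inE => /andP[_ yi] j; rewrite [RHS]inE.
  apply/idP/eqP => [|->]; last by rewrite inE in_setT.
  rewrite inE => /andP[_ yj].
  have := phase (leq_trans (ltn_ord j) ks) (leq_trans (ltn_ord i) ks) yj yi.
  rewrite -addn1 -[i.+1]addn1 => /eqP; rewrite eqn_modDr.
  by rewrite !modn_small ?(leq_trans (ltn_ord _) kg) // => /eqP/val_inj.
have k0 : 0 < k by rewrite lt0n; apply: contraTneq (outdeg z) => ->.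
apply/negP; rewrite -ltnNge -(ltn_pmul2l k0) big_distrr /=.
apply: (@leq_trans (\sum_(i in [set: 'I_k]) #|T|.+1)).
  by rewrite sum_nat_const cardsT card_ord ltn_pmul2l.
apply: leq_sum => i _; rewrite (_ : [set y in _ | _] = reach i.+1 z).
  exact: card_reach.
by apply/setP => y; rewrite !inE.
Qed.

Hypothesis e_asym : forall x y, e x y -> ~~ e y x.

(* If all closed walks were even, the arcs leaving a ball would form an oriented
   bipartite graph inside the next ball, so that the ball sizes b_j satisfy
   b_j n < b_(j+1)^2; this forces b_4 > 3n/4, after which every vertex has an
   inneighbour in the ball. *)
Lemma bipartite_degree : 6 <= s -> g = 2 -> 4 < k.
Proof.
move=> s6 g2; rewrite ltnNge; apply/negP => k4.
have outdeg4 x : #|T| < 4 * #|[set y | e x y]|.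
  by apply: leq_trans (outdeg x) _; rewrite leq_mul2r k4 orbT.
have indeg4 x : #|T| < 4 * #|[set y | e y x]|.
  by apply: leq_trans (indeg x) _; rewrite leq_mul2r k4 orbT.
pose b j := #|ball j z|.
pose even_phase := \bigcup_(i < 7 | ~~ odd i) reach i z.
have even_phaseE i y : i <= 6 -> y \in reach i z -> (y \in even_phase) = ~~ odd i.
  move=> i6 yi; apply/bigcupP/idP => [[j oj yj]|oi].
    have j6 : j <= 6 by rewrite -ltnS.
    have := phase (leq_trans i6 s6) (leq_trans j6 s6) yi yj.
    by rewrite g2 !modn2; case: (odd i); case: (odd j) oj.
  by exists (Ordinal (i6 : i < 7)).
have ball_gt0 j : 0 < b j.
  by rewrite card_gt0; apply/set0Pn; exists z; apply/ballP; exists 0; rewrite ?reach0.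
have grow j : j <= 5 -> b j * #|T| < b j.+1 ^ 2.
  move=> j5; pose E := [set p | (p.1 \in ball j z) && e p.1 p.2].
  have cardE : #|E| = \sum_(u in ball j z) #|[set y | e u y]|.
    rewrite -sum1_card (eq_bigl _ _ (fun p => in_set _ p)).
    rewrite -(pair_big_dep (mem (ball j z)) e (fun _ _ => 1)) /=.
    by apply: eq_bigr => u _; rewrite -sum1_card (eq_bigl _ _ (fun p => in_set _ p)).
  have arcsE : b j * #|T| < 4 * #|E|.
    have n0 : 0 < #|T| by apply/card_gt0P; exists z.
    apply: (@leq_trans (b j * #|T|.+1)); first by rewrite ltn_pmul2l.
    rewrite cardE big_distrr /= -sum_nat_const; apply: leq_sum => u _.
    exact: outdeg4.
  apply: leq_trans arcsE _; rewrite /b -(cardsID even_phase).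
  apply: leq_trans (nat_AGM2 _ _); rewrite leq_mul2l /= -cardsX.
  (* Writing the even endpoint of each arc first is injective because opposite arcs are excluded.
     Thus [#|E|] is at most the product of the two sides of the next ball, hence at most a quarter
     of its squared size. *)
  pose fold p : T * T := if p.1 \in even_phase then p else (p.2, p.1).
  rewrite -(card_in_imset (f := fold) (D := E)).
    apply/subset_leq_card/subsetP => q /imsetP[[u y] + ->].
    rewrite in_set /= => /andP[uj uy].
    have yj := ball_step uj uy; have uj' : u \in ball j.+1 z.
      by case/ballP: uj => i ij ui; apply/ballP; exists i; rewrite ?leqW.
    have [i ij ui] := ballP _ _ _ uj.
    have i5 : i <= 5 by apply: leq_trans ij j5.
    have ue := even_phaseE _ _ (leqW i5) ui.
    have ye : (y \in even_phase) = ~~ odd i.+1.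
      by apply: even_phaseE => //; apply/reachS; exists u.
    rewrite /fold /= ue; case: (boolP (odd i)) ue ye => /= oi ue ye.
      by rewrite in_setX in_setI in_setD /= yj uj' ye ue oi.
    by rewrite in_setX in_setI in_setD /= yj uj' ye ue negbK oi.
  move=> [u y] [u' y']; rewrite !in_set /= => /andP[_ uy] /andP[_ uy'].
  rewrite /fold /=; case: ifP => _; case: ifP => _ [uE yE].
  - by rewrite uE yE.
  - by move: (e_asym uy); rewrite uE yE uy'.
  - by move: (e_asym uy); rewrite uE yE uy'.
  - by rewrite uE yE.
have full j : 3 * #|T| < 4 * b j -> b j.+1 = #|T|.
  move=> bj; rewrite /b -cardsT; congr #|pred_of_set _|; apply/setP => w.
  rewrite in_setT.
  have : ~~ [disjoint ball j z & [set u | e u w]].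
    apply/negP => dis.
    have : #|ball j z :|: [set u | e u w]| <= #|T| by apply: max_card.
    rewrite cardsU (disjoint_setI0 dis) cards0 subn0 -/(b j).
    by have := indeg4 w; lia.
  rewrite -setI_eq0 => /set0Pn[u]; rewrite in_setI in_set => /andP[uj uw].
  exact: ball_step uj uw.
have n0 : 0 < #|T| by apply/card_gt0P; exists z.
have b1 : #|T| < 4 * b 1.
  apply: leq_trans (outdeg4 z) _; rewrite leq_mul2l; apply/orP; right.
  apply/subset_leq_card/subsetP => y; rewrite in_set => zy.
  by apply/ballP; exists 1; rewrite ?reach1.
have b4 : 3 * #|T| < 4 * b 4.
  exact: square_growth b1 (grow 1 isT) (grow 2 isT) (grow 3 isT).
(* Now [b 5] is n, so one more count of arcs gives n^2 < (b 6)^2, although [b 6] is at most n. *)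
have := grow 5 isT; rewrite (full 4 b4) ltnNge mulnn leq_sqr.
by rewrite max_card.
Qed.
End Phases.
End Degrees.
End ShortWalks.

(** * Closed walks of prescribed length *)

(** Descent on [g], starting from [a], with the invariant that all multiples of [g] from
    [(a - g) * D] on lie in [S]. If some [l <= D] in [S] is not a multiple of [g], replace [g] by
    [h = gcdn g l]: fewer than [g %/ h], hence at most [g - h], copies of [l] correct the residue,
    at a cost of at most [(g - h) * D]. *)
Lemma bounded_frobenius (S : pred nat) (D a : nat) :
  S 0 -> (forall m n, S m -> S n -> S (m + n)) -> S a -> 0 < a ->
  exists g, [/\ 0 < g, forall l, S l -> l <= D -> g %| l
    & forall m, g %| m -> a * D <= m -> S m].
Proof.
move=> S0 SD Sa a0.
have SM u l : S l -> S (u * l).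
  by move=> Sl; elim: u => [|u IHu]; rewrite ?mul0n // mulSn; apply: SD.
suff main g : 0 < g <= a ->
    (forall m, g %| m -> (a - g) * D <= m -> S m) ->
    exists g, [/\ 0 < g, forall l, S l -> l <= D -> g %| l
      & forall m, g %| m -> a * D <= m -> S m].
  apply: (main a); first by rewrite a0 leqnn.
  by move=> m /dvdnP[u ->] _; apply: SM.
elim/ltn_ind: g => g IHg /andP[g0 ga] Sg.
have [/existsP[[l /= lD] /andP[Sl gl]]|] :=
    boolP [exists l : 'I_D.+1, S l && ~~ (g %| l)]; last first.
  rewrite negb_exists => /forallP gS; exists g; split=> // [l Sl lD|m gm aDm].
    by have := gS (Ordinal (lD : l < D.+1)); rewrite Sl negbK.
  by apply: Sg => //; apply: leq_trans aDm; rewrite leq_mul2r leq_subr orbT.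
set h := gcdn g l; have h0 : 0 < h by rewrite gcdn_gt0 g0.
have hg : h %| g by apply: dvdn_gcdl.
have ltg : h < g.
  rewrite ltn_neqAle (dvdn_leq g0 hg) andbT.
  by apply: contraNneq gl => <-; apply: dvdn_gcdr.
apply: (IHg h) => //; first by rewrite h0 (leq_trans (ltnW ltg)).
move=> m hm am; have [q mE] := dvdnP hm.
have [c cg] := Bezoutl l g0; rewrite -/h => gc.
(* By Bezout, [(g - c) * l] is congruent to [h] modulo [g], so [q * (g - c)] copies of [l] are
   congruent to [m]. This multiplier may be reduced modulo [g %/ h], since [g] divides
   [(g %/ h) * l]. *)
set u := (q * (g - c)) %% (g %/ h).
have ug : u < g %/ h by rewrite ltn_mod divn_gt0 // dvdn_leq.
have ugh : u <= g - h.
  have [w gE] := dvdnP hg; have w0 : 0 < w by case: w gE g0 => // ->.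
  rewrite -ltnS; apply: leq_trans ug _; rewrite gE mulnK //.
  by rewrite -{1}(prednK w0) ltnS -{2}[h]mul1n -mulnBl subn1 leq_pmulr.
have ulD : u * l <= (g - h) * D by apply: leq_mul.
have ulm : (a - g) * D + u * l <= m.
  apply: leq_trans am; apply: leq_trans (leq_add (leqnn _) ulD) _.
  by rewrite -mulnDl addnBA ?subnK // ltnW.
have ulm' : u * l <= m by apply: leq_trans ulm; apply: leq_addl.
have gul : g %| m - u * l.
  rewrite -eqn_mod_dvd //.
  have -> : u * l = q * (g - c) * l %[mod g].
    have gl0 : g %| (q * (g - c)) %/ (g %/ h) * (g %/ h) * l.
      rewrite -mulnA; apply: (dvdn_mull (d := g)).
      have [w lE] := dvdnP (dvdn_gcdr g l).
      by rewrite [X in _ %/ h * X]lE -/h mulnCA divnK // dvdn_mull.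
    rewrite [in RHS](divn_eq (q * (g - c)) (g %/ h)) -/u mulnDl; symmetry.
    by rewrite -[LHS]modnDml (eqP gl0) add0n.
  rewrite -(eqn_modDr (q * c * l)) -mulnDl -mulnDr subnK; last exact: ltnW.
  rewrite [X in _ == X %[mod _]]mulnAC modnMl mE -mulnA -mulnDr.
  by apply: (dvdn_mull (d := g)).
rewrite -(subnK ulm'); apply: SD (SM _ _ Sl); apply: Sg => //.
by rewrite leq_subRL // addnC.
Qed.

Lemma closed_walk (T : finType) (e : rel T) (k t : nat) (x0 : T) :
  2 < k -> 9 * k ^ 6 <= t ->
  (forall j, 2 < j -> j < k -> j %| t) ->
  (forall x y, e x y -> ~~ e y x) ->
  (forall x, #|T| < k * #|[set y | e x y]|) ->
  (forall x, #|T| < k * #|[set y | e y x]|) ->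
  exists w : nat -> T, w t = w 0 /\ forall j, j < t -> e (w j) (w j.+1).
Proof.
(* The radius [s - 2 = k + 4] has to be at least [k] to bound the period, and at least 6 for the
   bipartite case. *)
move=> k2 tk kmin e_asym outdeg indeg; set s := k + 6.
have [z [r [rD ret]]] : exists z r, r + s <= k ^ 2 * s /\
    forall y, y \in ball e (s - 2) z ->
      exists2 j, 0 < j <= r.+1 & z \in reach e j y.
  by apply: returning_vertex => //; rewrite /s; lia.
set D := k ^ 2 * s in rD.
have [a /andP[a0 ar] za] : exists2 a, 0 < a <= r.+1 & z \in reach e a z.
  by apply: ret; apply/ballP; exists 0; rewrite ?reach0.
(* Since [k + 6 <= 3 * k], both [a] and [D] are at most [3 * k ^ 3]; this is the source of the bound
   [9 * k ^ 6]. *)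
have aD : a * D <= t.
  have D3 : D <= 3 * k ^ 3.
    rewrite /D /s mulnC [k ^ 3]expnS mulnA leq_mul2r; apply/orP; right; lia.
  have aD : a <= D by rewrite /s in rD; lia.
  apply: leq_trans (leq_mul (leq_trans aD D3) D3) _; apply: leq_trans tk.
  by rewrite mulnACA -expnD.
have [g [g0 gdvd gt]] : exists g, [/\ 0 < g,
    forall l, z \in reach e l z -> l <= D -> g %| l
    & forall m, g %| m -> a * D <= m -> z \in reach e m z].
  apply: (bounded_frobenius (S := fun m => z \in reach e m z)) => //.
    by rewrite reach0.
  by move=> m n zm zn; apply: reachD zm zn.
(* Both walks to [y] are closed up by the same return to [z], and the resulting closed walks still
   have length at most [D]. *)
have phase i j y : i <= s - 2 -> j <= s - 2 ->
    y \in reach e i z -> y \in reach e j z -> i = j %[mod g].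
  move=> i_s js yi yj.
  have [c /andP[_ cr] zc] : exists2 c, 0 < c <= r.+1 & z \in reach e c y.
    by apply: ret; apply/ballP; exists i.
  apply/eqP; rewrite -(eqn_modDr c) (eqP (gdvd _ (reachD yi zc) _)); last by lia.
  by rewrite (eqP (gdvd _ (reachD yj zc) _)) //; lia.
have gk : g < k by apply: (period_lt outdeg phase); rewrite /s; lia.
have g_t : g %| t.
  case: (ltnP 2 g) => [g2|]; first exact: kmin.
  case: g g0 {gdvd gt gk} phase => [//|[|[|//]]] _ phase _; first exact: dvd1n.
  (* Minimality of [k] says nothing about 2 itself, so for [g = 2] divisibility comes from 4. *)
  have k4 : 4 < k.
    by apply: (bipartite_degree outdeg indeg phase) => //; rewrite /s; lia.
  exact: dvdn_trans (kmin 4 _ _).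
have [w [w0 wt we]] := reach_seq (gt t g_t aD).
by exists w; rewrite w0 wt.
Qed.

(** * Moments of the degrees in a random sample *)

Section Resampling.
Variables (V I : finType).

Definition upd (v : {ffun I -> V}) (i : I) (u : V) : {ffun I -> V} :=
  [ffun j => if j == i then u else v j].

Lemma updE v i u : upd v i u i = u.
Proof. by rewrite ffunE eqxx. Qed.

Lemma upd_neq v i u j : j != i -> upd v i u j = v j.
Proof. by rewrite ffunE => /negPf->. Qed.

Lemma upd_id v i : upd v i (v i) = v.
Proof. by apply/ffunP => j; rewrite ffunE; case: eqP => [->|]. Qed.

Lemma upd_upd v i u u' : upd (upd v i u) i u' = upd v i u'.
Proof. by apply/ffunP => j; rewrite !ffunE; case: eqP. Qed.

Local Open Scope ring_scope.

(** Exchanging the stored value at [i] with the fresh value [u] is an involution on pairs, so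
    resampling a coordinate preserves averages. *)
Lemma sum_upd (M : nmodType) (F : {ffun I -> V} -> M) (i : I) :
  \sum_v \sum_u F (upd v i u) = (\sum_v F v) *+ #|V|.
Proof.
rewrite pair_big /=.
have swapK : involutive (fun p : {ffun I -> V} * V => (upd p.1 i p.2, p.1 i)).
  by case=> v u /=; rewrite updE upd_upd upd_id.
rewrite (reindex_inj (can_inj swapK)) /=.
under eq_bigr do rewrite upd_upd upd_id.
rewrite -(pair_big xpredT xpredT (fun v (_ : V) => F v)) /= -sumrMnl.
by apply: eq_bigr => v _; rewrite sumr_const.
Qed.

Section Deviation.
Variables (R : realType) (e : rel V).
Hypothesis e_irr : irreflexive e.

(** The arc indicator minus its mean over [u], scaled by |V| to avoid division. *)
Definition excess (x u : V) : R :=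
  #|V|%:R * (e x u)%:R - #|[set y | e x y]|%:R.

Definition deviation (i : I) (v : {ffun I -> V}) : R :=
  \sum_(j | j != i) excess (v i) (v j).

Lemma sum_rel x : \sum_u (e x u)%:R = #|[set y | e x y]|%:R :> R.
Proof.
by rewrite card_set_sum natr_sum.
Qed.

Lemma sum_excess x : \sum_u excess x u = 0.
Proof.
by rewrite big_split /= -big_distrr /= sum_rel sumr_const mulNrn -[X in _ - X]mulr_natl subrr.
Qed.

Lemma deviationE i v : deviation i v =
  #|V|%:R * #|[set j | e (v i) (v j)]|%:R -
  (#|I|.-1)%:R * #|[set y | e (v i) y]|%:R.
Proof.
rewrite /deviation big_split /= sumr_const cardC1 mulNrn -[X in _ - X]mulr_natl; congr (_ - _).
rewrite -big_distrr /= card_set_sum natr_sum.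
by rewrite [X in _ = _ * X](bigD1 i) //= e_irr add0r.
Qed.

Lemma excess_sq x u : excess x u ^+ 2 <= #|V|%:R ^+ 2.
Proof.
have : #|[set y | e x y]|%:R <= #|V|%:R :> R by rewrite ler_nat max_card.
have : 0 <= #|[set y | e x y]|%:R :> R by [].
rewrite /excess; case: (e x u); rewrite /= ?mulr1 ?mulr0; nra.
Qed.

(* The cross terms vanish: resampling the coordinate j averages the excess of
   (v i, v j) to zero. *)
Lemma second_moment (i : I) : (0 < #|V|)%N ->
  \sum_v deviation i v ^+ 2 <= #|I|%:R * #|V|%:R ^+ 2 * (#|V| ^ #|I|)%:R.
Proof.
move=> n0.
have cross j l : j != i -> l != j ->
    \sum_(v : {ffun I -> V}) excess (v i) (v j) * excess (v i) (v l) = 0.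
  move=> ji lj; apply/eqP.
  have := sum_upd (fun v => excess (v i) (v j) * excess (v i) (v l)) j.
  rewrite big1 => [/esym/eqP|v _]; first by rewrite mulrn_eq0 gtn_eqF.
  have ij : i != j by rewrite eq_sym.
  under eq_bigr do rewrite updE (upd_neq _ _ lj) (upd_neq _ _ ij).
  by rewrite -big_distrl /= sum_excess mul0r.
rewrite (_ : \sum_v _ =
    \sum_(j | j != i) \sum_(v : {ffun I -> V}) excess (v i) (v j) ^+ 2); last first.
  under eq_bigr do rewrite expr2 /deviation big_distrlr /=.
  rewrite exchange_big; apply: eq_bigr => j ji.
  rewrite exchange_big (bigD1 j) //= [X in _ + X]big1 ?addr0.
    by under eq_bigr do rewrite -expr2.
  by move=> l /andP[li lj]; apply: cross.
rewrite -mulrA.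
have : \sum_(j | j != i) \sum_(v : {ffun I -> V}) excess (v i) (v j) ^+ 2 <=
    \sum_(j | j != i) #|V|%:R ^+ 2 * (#|V| ^ #|I|)%:R.
  apply: ler_sum => j _; rewrite -card_ffun mulr_natr -sumr_const.
  by apply: ler_sum => v _; apply: excess_sq.
move/le_trans; apply; rewrite sumr_const cardC1 -[leLHS]mulr_natl.
by rewrite ler_wpM2r ?mulr_ge0 ?exprn_ge0 // ler_nat leq_pred.
Qed.

(** By Chebyshev a given index deviates in a proportion of at most 1/(theta^2 |I|) of the samples.
    Summing over the indices, the mean number of deviating ones is at most 1/theta^2, whatever the
    sample size. *)
Lemma few_deviating (theta : R) : 0 < theta -> (0 < #|V|)%N ->
  (\sum_(v : {ffun I -> V})
     #|[set i | (deviation i v < - (theta * #|V|%:R * #|I|%:R))%R]|)%:R * theta ^+ 2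
  <= (#|V| ^ #|I|)%:R :> R.
Proof.
move=> th0 n0; set bound := theta * _ * _.
have [m0|m0] := posnP #|I|.
  rewrite big1 => [|v _]; first by rewrite mul0r.
  by apply/eqP; rewrite -leqn0 -m0 max_card.
have chebyshev i : #|[set v | (deviation i v < - bound)%R]|%:R * theta ^+ 2 * #|I|%:R
    <= (#|V| ^ #|I|)%:R :> R.
  have n20 : 0 < #|V|%:R ^+ 2 * #|I|%:R :> R by rewrite mulr_gt0 ?exprn_gt0 ?ltr0n.
  rewrite -(ler_pM2r n20) [leRHS]mulrC [X in _ <= X * _]mulrC.
  apply: le_trans (second_moment i n0).
  rewrite [leLHS](_ : _ = #|[set v | (deviation i v < - bound)%R]|%:R * bound ^+ 2).
    rewrite mulr_natl -sumr_const big_mkcond /=; apply: ler_sum => v _.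
    rewrite inE; case: ifP => [|_]; last exact: sqr_ge0.
    have : 0 <= bound by rewrite !mulr_ge0 // ltW.
    by nra.
  by rewrite /bound; ring.
have : \sum_i #|[set v | (deviation i v < - bound)%R]|%:R * theta ^+ 2 * #|I|%:R
   <= \sum_(i : I) (#|V| ^ #|I|)%:R :> R by apply: ler_sum.
rewrite sumr_const -[leRHS]mulr_natr -!big_distrl /= ler_pM2r ?ltr0n //.
apply: le_trans; rewrite -natr_sum ler_wpM2r ?sqr_ge0 // ler_nat.
under eq_bigr do rewrite card_set_sum.
by rewrite exchange_big leq_sum // => i _; rewrite card_set_sum.
Qed.
End Deviation.
End Resampling.

(** * Closed walk patterns of positive density *)

Section Sampling.
Local Open Scope ring_scope.

(** Indexing the walk by ['Z_t] includes the closing arc, as the case where [a + 1] wraps around to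
    0. *)
Definition walk_pattern (V : finType) (e : rel V) (t m : nat)
    (W : {ffun 'Z_t -> 'I_m}) : {set {ffun 'I_m -> V}} :=
  [set v : {ffun 'I_m -> V} | [forall a : 'Z_t, e (v (W a)) (v (W (a + 1)))]].

(* Deleting the fewer than b indices whose sampled degrees deviate leaves a
   digraph to which closed_walk applies. *)
Lemma sample_walk (R : realType) (k t m b : nat) (eta : R) (V : finType)
    (e : rel V) (v : {ffun 'I_m -> V}) :
  (2 < k)%N -> (9 * k ^ 6 <= t)%N ->
  (forall j, (2 < j)%N -> (j < k)%N -> (j %| t)%N) ->
  (forall x y, e x y -> ~~ e y x) -> (0 < #|V|)%N -> 0 < eta ->
  (forall x, (1 + eta) * #|V|%:R / k%:R <= #|[set y | e x y]|%:R :> R) ->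
  (forall x, (1 + eta) * #|V|%:R / k%:R <= #|[set y | e y x]|%:R :> R) ->
  (b <= m)%N -> (1 + eta + k%:R * b%:R) < eta * m%:R / 2 ->
  let bad (e' : rel V) :=
    [set i | (deviation R e' i v < - (eta / (2 * k%:R) * #|V|%:R * #|'I_m|%:R))%R] in
  (#|bad e| + #|bad (fun x y => e y x)| < b)%N ->
  exists W : {ffun 'Z_t -> 'I_m}, v \in walk_pattern e W.
Proof.
move=> k2 tk kmin e_asym n0 eta0 outdeg indeg bm mlarge bad few_bad.
have e_irr x : e x x = false by apply/negP => exx; have := e_asym _ _ exx; rewrite exx.
set J := ~: (bad e :|: bad (fun x y => e y x)).
have cardJ : (#|~: J| < b)%N.
  by rewrite setCK; apply: leq_ltn_trans few_bad; apply: leq_card_setU.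
have k0 : 0 < k%:R :> R by rewrite ltr0n; lia.
(* The sampled degree is at least (1 + eta)(m - 1)/k - eta m/(2k), and at most [b] of it is lost
   outside [J]. The bound on [m] is exactly what leaves more than m/k. *)
have degJ (e' : rel V) i : irreflexive e' -> i \notin bad e' ->
    (forall x, (1 + eta) * #|V|%:R / k%:R <= #|[set y | e' x y]|%:R :> R) ->
    (m < k * #|[set j in J | e' (v i) (v j)]|)%N.
  move=> irr' ibad deg'.
  have : (#|[set j | e' (v i) (v j)]| <= #|[set j in J | e' (v i) (v j)]| + b)%N.
    rewrite -(cardsID J [set j | e' (v i) (v j)]); apply: leq_add.
      by apply/subset_leq_card/subsetP => j; rewrite !inE andbC.
    apply: leq_trans (ltnW cardJ); apply/subset_leq_card/subsetP => j.
    by rewrite in_setD in_setC => /andP[].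
  rewrite -(ler_nat R) natrD -(ltr_nat R) natrM.
  move: ibad; rewrite inE -leNgt deviationE // card_ord => dev.
  set D := #|[set j in J | _]|%:R; set D' := #|[set j | _]|%:R in dev * => DD.
  have m0 : (0 < m)%N by lia.
  have mE : m.-1%:R = m%:R - 1 :> R by rewrite -subn1 natrB.
  have dx := deg' (v i); set d := #|[set y | _]|%:R in dx dev.
  have nR : 0 < #|V|%:R :> R by rewrite ltr0n.
  rewrite mE in dev.
  have m1 : 0 <= m%:R - 1 :> R by rewrite subr_ge0 ler1n.
  have h1 : (m%:R - 1) * ((1 + eta) * #|V|%:R / k%:R) <= (m%:R - 1) * d.
    by rewrite ler_wpM2l.
  have h2 : #|V|%:R * ((m%:R - 1) * (1 + eta)) <=
            #|V|%:R * (k%:R * D' + eta * m%:R / 2).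
    have : k%:R * ((m%:R - 1) * ((1 + eta) * #|V|%:R / k%:R) -
               eta / (2 * k%:R) * #|V|%:R * m%:R) <= k%:R * (#|V|%:R * D').
      by rewrite ler_pM2l //; lra.
    have -> : k%:R * ((m%:R - 1) * ((1 + eta) * #|V|%:R / k%:R) -
               eta / (2 * k%:R) * #|V|%:R * m%:R) =
           #|V|%:R * ((m%:R - 1) * (1 + eta)) - #|V|%:R * (eta * m%:R / 2).
      by field; rewrite gt_eqF.
    have -> : k%:R * (#|V|%:R * D') = #|V|%:R * (k%:R * D') by ring.
    by rewrite mulrDr; lra.
  rewrite ler_pM2l // in h2.
  have h3 : k%:R * D' <= k%:R * D + k%:R * b%:R by rewrite -mulrDr ler_pM2l.
  by lra.
have [i0 i0J] : exists i0, i0 \in J.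
  apply/set0Pn; apply: contraTneq cardJ => ->.
  by rewrite setC0 cardsT card_ord -leqNgt.
pose T := {i : 'I_m | i \in J}; pose eT (x y : T) := e (v (val x)) (v (val y)).
have cardT : (#|{: T}| <= m)%N by rewrite card_sig -[leqRHS]card_ord max_card.
have degT (e' : rel V) (x : T) :
    #|[set y : T | e' (v (val x)) (v (val y))]| =
    #|[set j in J | e' (v (val x)) (v j)]|.
  rewrite -(card_imset _ val_inj); congr #|pred_of_set _|.
  apply/setP => j; apply/imsetP/idP => [[y + ->]|].
    by move=> yx; rewrite in_set (valP y) /=; move: yx; rewrite inE.
  by rewrite inE => /andP[jJ ej]; exists (Sub j jJ) => //; rewrite inE.
have [|x|x|w [wt we]] := closed_walk (Sub i0 i0J : T) k2 tk kmin (e := eT).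
- by move=> x y; apply: e_asym.
- apply: leq_ltn_trans cardT _; rewrite (degT e); apply: degJ => //.
  by have := valP x; rewrite !inE negb_or => /andP[].
- apply: leq_ltn_trans cardT _; rewrite (degT (fun x y => e y x)).
  apply: (degJ (fun x y => e y x)) => //.
  by have := valP x; rewrite !inE negb_or => /andP[].
exists [ffun a : 'Z_t => val (w (a : nat))]; rewrite inE; apply/forallP => a.
have t1 : (1 < t)%N.
  have : (0 < k ^ 6)%N by rewrite expn_gt0; lia.
  by move: tk; lia.
rewrite !ffunE; have ta : (a < t)%N by rewrite -[t in (_ < t)%N](Zp_cast t1).
have a1E : (a + 1)%R = (a.+1 %% t)%N :> nat.
  by rewrite /=; move: (nat_of_ord a) => n; rewrite (Zp_cast t1) modnDmr addn1.
have := we a ta; rewrite a1E; case: (ltnP a.+1 t) => at1.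
  by rewrite modn_small.
have -> : a.+1 = t by apply/eqP; rewrite eqn_leq ta.
by rewrite modnn wt.
Qed.
(** The sample size [m] is fixed before [V], so the number of index walks [W] does not depend on
    [V]. At least half of the samples contain one, and the pigeonhole principle yields a frequent
    [W]. *)
Lemma frequent_pattern (R : realType) (k t : nat) (eta : R) :
  (2 < k)%N -> (9 * k ^ 6 <= t)%N ->
  (forall j, (2 < j)%N -> (j < k)%N -> (j %| t)%N) -> 0 < eta ->
  exists m : nat, forall (V : finType) (e : rel V),
    (forall x y, e x y -> ~~ e y x) -> (0 < #|V|)%N ->
    (forall x, (1 + eta) * #|V|%:R / k%:R <= #|[set y | e x y]|%:R :> R) ->
    (forall x, (1 + eta) * #|V|%:R / k%:R <= #|[set y | e y x]|%:R :> R) ->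
    exists W : {ffun 'Z_t -> 'I_m},
      (#|V| ^ m <= 2 * #|{: {ffun 'Z_t -> 'I_m}}| * #|walk_pattern e W|)%N.
Proof.
move=> k2 tk kmin eta0; set theta := eta / (2 * k%:R).
have k0 : 0 < k%:R :> R by rewrite ltr0n; lia.
have th0 : 0 < theta by rewrite divr_gt0 // mulr_gt0.
(* Both directions together have on average at most 2/theta^2, hence at most b/2, bad indices. By
   Markov at most half of the samples have [b] or more. *)
set b := Num.bound (4 / theta ^+ 2).
have btheta : 4 <= b%:R * theta ^+ 2.
  rewrite -ler_pdivrMr ?exprn_gt0 // ltW // archi_boundP //.
  by rewrite divr_ge0 // ltW // exprn_gt0.
set m0 := Num.bound (2 * (1 + eta + k%:R * b%:R) / eta).
have m0P : 2 * (1 + eta + k%:R * b%:R) / eta < m0%:R.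
  by apply: archi_boundP; rewrite divr_ge0 ?mulr_ge0 ?addr_ge0 ?mulr_ge0 // ltW.
exists (m0 + b).+1 => V e e_asym n0 outdeg indeg; set m := (m0 + b).+1.
have mlarge : 1 + eta + k%:R * b%:R < eta * m%:R / 2.
  rewrite ltr_pdivrMr // in m0P.
  have : m0%:R * eta <= eta * m%:R.
    by rewrite mulrC ler_pM2l // ler_nat /m -addnS leq_addr.
  by lra.
pose bad (e' : rel V) (v : {ffun 'I_m -> V}) :=
  [set i | (deviation R e' i v < - (theta * #|V|%:R * #|'I_m|%:R))%R].
pose nbad v := (#|bad e v| + #|bad (fun x y => e y x) v|)%N.
pose good := [set v | (nbad v < b)%N].
have nbad_sum : (\sum_v nbad v)%:R * theta ^+ 2 <= 2 * (#|V| ^ m)%:R :> R.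
  have h1 := @few_deviating _ 'I_m R e _ th0 n0.
  have h2 := @few_deviating _ 'I_m R (fun x y => e y x) _ th0 n0.
  rewrite /nbad big_split /= natrD mulrDl.
  apply: le_trans (lerD h1 h2) _; rewrite (_ : #|'I_m| = m) ?card_ord //.
  by rewrite -mulr2n mulr_natl.
have good_half : (#|V| ^ m <= 2 * #|good|)%N.
  have markov : (#|~: good| * b <= \sum_v nbad v)%N.
    rewrite -sum_nat_const big_mkcond /=; apply: leq_sum => v _.
    by rewrite !inE -leqNgt; case: leqP.
  have := cardsC good; rewrite card_ffun card_ord => goodE.
  have : #|~: good|%:R * 4 <= 2 * (#|V| ^ m)%:R :> R.
    apply: le_trans nbad_sum; apply: (@le_trans _ _ (#|~: good|%:R * (b%:R * theta ^+ 2))).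
      by rewrite ler_wpM2l.
    by rewrite mulrA -natrM ler_wpM2r ?sqr_ge0 // ler_nat.
  rewrite -!natrM ler_nat; lia.
have good_pat v : v \in good ->
    exists2 W : {ffun 'Z_t -> 'I_m}, W \in setT & v \in walk_pattern e W.
  rewrite inE => vgood; have [|//|W vW] := sample_walk k2 tk kmin e_asym n0 eta0
    outdeg indeg _ mlarge (v := v) (b := b); last by exists W.
  by rewrite /m -addSn leq_addl.
have good0 : (0 < #|good|)%N.
  rewrite lt0n; apply: contraTneq good_half => ->.
  by rewrite muln0 -ltnNge expn_gt0 n0.
have [W _ WP] := pigeonhole good0 good_pat.
exists W; apply: leq_trans good_half _; rewrite -mulnA leq_mul2l /=.
apply: leq_trans WP _; rewrite cardsT leq_mul2l; apply/orP; right.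
by apply/subset_leq_card/subsetP => v; rewrite in_set => /andP[].
Qed.
End Sampling.

(** * Supersaturation and blow-ups *)

Section Supersaturation.
Variables (I : finType).

(** One coordinate of Erdos's supersaturation argument: many values [u] extend a positive proportion
    of the tuples; boundedly many of these values are fixed, and the pigeonhole principle selects a
    subset [S] that works simultaneously for a positive proportion. *)
Lemma common_extensions (c l : nat) : exists N c', forall (V : finType) (i : I)
    (Q : {set {ffun I -> V}}),
  N <= #|V| -> #|V| ^ #|I| <= c * #|Q| ->
  exists2 S : {set V}, l <= #|S| &
    #|V| ^ #|I| <= c' * #|[set v | [forall u in S, upd v i u \in Q]]|.
Proof.
(* Of [K] rich values, a tuple accepts at least K/(2c) = 2(l + 1) on average, so a proportion of at
   least 1/(4c) of the tuples accept [l] or more. The factor [2 ^ K] below counts the possible sets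
   of accepted values. *)
pose K := 4 * c * l.+1.
exists (2 * c * K).+1, (2 * c.*2 * 2 ^ K) => V i Q nN QM.
set n := #|V| in nN QM *; set M := n ^ #|I| in QM *.
have n0 : 0 < n by apply: leq_ltn_trans nN.
have M0 : 0 < M by rewrite expn_gt0 n0.
have c0 : 0 < c by case: c QM {K nN} => //; rewrite mul0n leqNgt M0.
pose ext u := [set v : {ffun I -> V} | upd v i u \in Q].
have sum_ext : \sum_u #|ext u| = n * #|Q|.
  under eq_bigr do rewrite card_set_sum.
  rewrite exchange_big (sum_upd (fun v => nat_of_bool (v \in Q))) -card_set_sum.
  by rewrite cardsE -mulr_natl natn.
pose rich := [set u | M <= 2 * c * #|ext u|].
(* Values that are not rich account for at most half of the guaranteed n M/c extensions. *)
have rich_card : n <= 2 * c * #|rich|.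
  have : 2 * c * (n * #|Q|) <= #|rich| * (2 * c * M) + n * M.
    rewrite -sum_ext big_distrr /= (bigID (mem rich)) /=; apply: leq_add.
      rewrite -sum_nat_const; apply: leq_sum => u _.
      by rewrite leq_mul2l /M -card_ffun max_card orbT.
    rewrite -[leqRHS]sum_nat_const big_mkcond /=; apply: leq_sum => u _.
    by rewrite inE; case: (leqP M) => //= /ltnW.
  have : 2 * (n * M) <= 2 * (n * (c * #|Q|)) by rewrite !leq_mul2l QM !orbT.
  have -> : 2 * (n * (c * #|Q|)) = 2 * c * (n * #|Q|) by ring.
  have -> : #|rich| * (2 * c * M) = (2 * c * #|rich|) * M by ring.
  move=> h1 h2; rewrite -(leq_pmul2r M0); lia.
have [Ks Kr cardKs] : exists2 Ks : {set V}, Ks \subset rich & #|Ks| = K.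
  have : K <= #|rich|.
    rewrite -(@leq_pmul2l (2 * c)) ?muln_gt0 //.
    by apply: leq_trans rich_card; apply: ltnW.
  by case/card_geqP => s [us ss sr]; exists [set x in s];
    [apply/subsetP => x; rewrite inE; apply: sr | rewrite cardsE; rewrite (card_uniqP us)].
pose T v := [set u in Ks | upd v i u \in Q].
pose P := [set v | l <= #|T v|].
have P_card : M <= 2 * c.*2 * #|P|.
  have : K * M <= 2 * c * \sum_(v in [set: {ffun I -> V}]) #|T v|.
    rewrite double_count -cardKs -sum_nat_const big_distrr /=.
    apply: leq_sum => u /(subsetP Kr); rewrite inE => /leq_trans; apply.
    by rewrite leq_mul2l; apply/orP; right; apply/subset_leq_card/subsetP => v;
      rewrite !inE.
  have : \sum_(v in [set: {ffun I -> V}]) #|T v| <= #|P| * K + M * l.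
    rewrite (eq_bigl xpredT) => [|v]; last by rewrite inE.
    rewrite (bigID (mem P)) /=; apply: leq_add.
      rewrite -sum_nat_const; apply: leq_sum => v _; rewrite -cardKs.
      by apply/subset_leq_card/subsetP => u; rewrite inE => /andP[].
    rewrite /M -card_ffun -sum_nat_const big_mkcond /=; apply: leq_sum => v _.
    by rewrite inE; case: (leqP l) => //= /ltnW.
  have K0 : 0 < K by rewrite /K !muln_gt0 c0.
  move=> h1 h2; rewrite -(leq_pmul2l K0).
  have h3 : K * M <= 2 * c * (#|P| * K + M * l).
    by apply: leq_trans h2 _; rewrite leq_mul2l h1 orbT.
  have h4 : 2 * (2 * c * (M * l)) <= K * M.
    have -> : 2 * (2 * c * (M * l)) = 4 * c * l * M by ring.
    by rewrite leq_mul2r /K leq_mul2l leqnSn !orbT.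
  have -> : K * (2 * c.*2 * #|P|) = 2 * (2 * c * (#|P| * K)).
    by rewrite -muln2; ring.
  by rewrite mulnDr in h3; lia.
have [S SK SP] : exists2 S, S \in [set S in powerset Ks | l <= #|S|] &
    #|P| <= #|[set S in powerset Ks | l <= #|S|]| * #|[set v in P | T v == S]|.
  apply: (@pigeonhole _ _ _ _ (fun v S => T v == S)).
    by rewrite lt0n; apply: contraTneq P_card => ->; rewrite muln0 -ltnNge.
  move=> v; rewrite inE => vP; exists (T v) => //; rewrite !inE vP andbT.
  by apply/subsetP => u; rewrite inE => /andP[].
exists S; first by move: SK; rewrite inE => /andP[].
apply: leq_trans P_card _; rewrite -[leqRHS]mulnA leq_mul2l; apply/orP; right.
apply: leq_trans SP _; apply: leq_mul.
  rewrite -cardKs -card_powerset; apply/subset_leq_card/subsetP => S'.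
  by rewrite inE => /andP[].
apply/subset_leq_card/subsetP => v; rewrite !inE => /andP[_ /eqP TS].
by apply/forall_inP => u; rewrite -TS inE => /andP[].
Qed.

(** Coordinates are treated one at a time: the tuples that stay in [Q] under every replacement from
    [Si] at [i] form a set of positive density, to which the induction applies. *)
Lemma blowup_along (l : nat) (s : seq I) : uniq s ->
  forall c, exists N c', forall (V : finType) (Q : {set {ffun I -> V}}),
  N <= #|V| -> #|V| ^ #|I| <= c * #|Q| ->
  exists2 S : I -> {set V}, forall i, i \in s -> l <= #|S i| &
    #|V| ^ #|I| <= c' * #|[set v : {ffun I -> V} | [forall v' : {ffun I -> V},
      [forall i, if i \in s then v' i \in S i else v' i == v i] ==> (v' \in Q)]]|.
Proof.
elim: s => [|i s IHs] /= => [_|/andP[is_s us]] c.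
  exists 0, c => V Q _ QM; exists (fun=> set0) => //.
  apply: leq_trans QM _; rewrite leq_mul2l; apply/orP; right.
  apply/subset_leq_card/subsetP => v vQ; rewrite inE; apply/forallP => v'.
  apply/implyP => /forallP v'E; rewrite (_ : v' = v) //.
  by apply/ffunP => i; apply/eqP/v'E.
have [N1 [c1 step]] := common_extensions c l.
have [N2 [c2 {}IHs]] := IHs us c1.
exists (maxn N1 N2), c2 => V Q; rewrite geq_max => /andP[nN1 nN2] QM.
have [Si lSi Q1M] := step V i Q nN1 QM.
have [S lS SM] := IHs V _ nN2 Q1M.
exists (fun j => if j == i then Si else S j).
  by move=> j; rewrite inE; case: eqP => [//|_ /=]; apply: lS.
apply: leq_trans SM _; rewrite leq_mul2l; apply/orP; right.
apply/subset_leq_card/subsetP => v; rewrite !inE => /forallP vP.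
apply/forallP => v'; apply/implyP => /forallP v'S.
(* Resetting coordinate [i] to that of [v] reaches the set handled by the induction; restoring
   [v' i], which lies in [Si], then lands in [Q]. *)
have : upd v' i (v i) \in [set v | [forall u in Si, upd v i u \in Q]].
  apply: (implyP (vP _)); apply/forallP => j; have := v'S j; rewrite inE ffunE.
  by case: eqP => [-> _|_ //]; rewrite (negPf is_s).
have := v'S i; rewrite !inE eqxx /= => v'i /forall_inP/(_ _ v'i).
by rewrite upd_upd upd_id.
Qed.

Lemma blowup (c l : nat) : exists N, forall (V : finType) (Q : {set {ffun I -> V}}),
  N <= #|V| -> #|V| ^ #|I| <= c * #|Q| ->
  exists2 S : I -> {set V}, forall i, l <= #|S i| &
    forall v : {ffun I -> V}, (forall i, v i \in S i) -> v \in Q.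
Proof.
have [N [c' blow]] := blowup_along l (enum_uniq I) c.
exists N.+1 => V Q nN QM; have [S lS SM] := blow V Q (ltnW nN) QM.
exists S => [i|v vS]; first by apply: lS; rewrite mem_enum.
have : 0 < #|V| ^ #|I| by rewrite expn_gt0 (leq_ltn_trans _ nN).
move/leq_trans/(_ SM); rewrite muln_gt0 => /andP[_ /card_gt0P[v0]].
rewrite inE => /forallP/(_ v)/implyP; apply.
by apply/forallP => i; rewrite mem_enum /= vS.
Qed.
End Supersaturation.

(** * Embedding the cycle into a blow-up *)

(** Greedy choice: fewer than [l] elements are already taken at each stage. *)
Lemma distinct_representatives (V : finType) (l : nat) (S : 'I_l -> {set V}) :
  (forall i, l <= #|S i|) ->
  exists2 x : 'I_l -> V, injective x & forall i, x i \in S i.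
Proof.
move=> lS.
have main m : m <= l -> exists s : seq V, [/\ size s = m, uniq s &
    forall x0 (i : 'I_l), i < m -> nth x0 s i \in S i].
  elim: m => [|m IHm] ml; first by exists [::].
  have [s [sm us sS]] := IHm (ltnW ml); pose im := Ordinal ml.
  have [y] : exists y, y \in S im :\: [set y in s].
    apply/card_gt0P; rewrite cardsD subn_gt0.
    apply: leq_trans (lS im); apply: leq_trans (ml); rewrite ltnS -[leqRHS]sm.
    apply: leq_trans (card_size s); apply/subset_leq_card/subsetP => y.
    by rewrite !inE => /andP[].
  rewrite !inE => /andP[ys yS]; exists (rcons s y).
  rewrite size_rcons rcons_uniq sm ys us; split=> // x0 i.
  rewrite nth_rcons sm ltnS leq_eqVlt; case: ltnP => [im' _|_]; first exact: sS.
  by rewrite orbF => im'; rewrite im'; rewrite (_ : i = im) //; apply/val_inj/eqP.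
have [s [sl us sS]] := main l (leqnn l).
case: l S lS main sl sS => [|l] S lS main sl sS.
  by exists (fun i : 'I_0 => False_rect V (notF (ltn_ord i))) => [[]|[]].
have [y0 _] : exists y, y \in S ord0.
  by apply/card_gt0P; apply: leq_trans (lS ord0).
exists (fun i => nth y0 s i) => [i j /eqP|i]; last exact: sS.
by rewrite nth_uniq ?sl // => /eqP/val_inj.
Qed.

Section CyclePotential.
Variables (C : ograph) (l t : nat) (c : 'I_l -> C).
Hypothesis t1 : 1 < t.
Hypothesis c_cycle : oriented_cycle c.
Hypothesis c_type : cycle_type c = t.
Local Open Scope ring_scope.

Lemma cycle_arcs i : arc (c (ordS i)) (c i) = ~~ arc (c i) (c (ordS i)).
Proof.
have [_ _ adj] := c_cycle.
have /orP[a|a] : adjacent (c i) (c (ordS i)) by apply/adj; exists i; left.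
  by rewrite a; apply/negbTE/arc_asym.
by rewrite a; apply/esym/arc_asym.
Qed.

(* The signed length of the traversal is the cycle type up to sign, hence it
   vanishes modulo t: this folds C onto a directed cycle of length t. *)
Lemma cycle_potential : exists h : 'I_l -> 'Z_t, forall i,
  if arc (c i) (c (ordS i)) then h (ordS i) = h i + 1 else h i = h (ordS i) + 1.
Proof.
pose sgn i : 'Z_t := if arc (c i) (c (ordS i)) then 1 else -1.
have sum_sgn : \sum_i sgn i = 0.
  have t0 : t%:R = 0 :> 'Z_t by apply: pchar_Zp.
  have -> : \sum_i sgn i = #|[set i | arc (c i) (c (ordS i))]|%:R -
                           #|[set i | arc (c (ordS i)) (c i)]|%:R.
    rewrite !card_set_sum !natr_sum -sumrB; apply: eq_bigr => i _.
    by rewrite /sgn cycle_arcs; case: (arc _ _); rewrite /= ?subr0 ?sub0r.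
  move: c_type; rewrite /cycle_type; move: #|_| #|_| => f b fbt.
  have [->|->] : f = (b + t)%N \/ b = (f + t)%N by lia.
    by rewrite natrD t0 addr0 subrr.
  by rewrite natrD t0 addr0 subrr.
(* Partial sums of the signs. At the last index [ordS i] is 0, and the vanishing total closes the
   potential up. *)
exists (fun i => \sum_(j < l | (j < i)%N) sgn j) => i.
have hS : \sum_(j < l | (j < ordS i)%N) sgn j = \sum_(j < l | (j < i)%N) sgn j + sgn i.
  rewrite addrC /=; case: (ltnP i.+1 l) => il.
    rewrite modn_small // (bigD1 i) //=; congr (_ + _); apply: eq_bigl => j.
    by rewrite ltnS [RHS]ltn_neqAle andbC.
  have il' : i.+1 = l by apply/eqP; rewrite eqn_leq il ltn_ord.
  rewrite il' modnn big_pred0 // -[LHS]sum_sgn (bigD1 i) //=.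
  congr (_ + _); apply: eq_bigl => j; rewrite [RHS]ltn_neqAle -ltnS il' ltn_ord.
  by rewrite andbT.
by rewrite hS; case aE: (arc _ _); rewrite [sgn i]/sgn aE ?subrK.
Qed.
End CyclePotential.

Lemma bigmin_le (T : finType) (F : T -> nat) (d : nat) (x : T) :
  \big[minn/d]_y F y <= F x.
Proof.
have: x \in index_enum T by apply: mem_index_enum.
elim: (index_enum T) => // y s IHs; rewrite big_cons inE geq_min.
by case/predU1P => [->|/IHs->]; rewrite ?leqnn ?orbT.
Qed.

(** The potential [h] folds the cycle onto the closed walk, and [c i] is sent into the class
    [S (W (h i))], so that every arc of the cycle runs between consecutive classes of the
    blow-up. *)
Lemma contains_cycle (R : realType) (k t : nat) (eta : R) (l : nat) :
  2 < k -> 9 * k ^ 6 <= t -> (forall j, 2 < j -> j < k -> j %| t) ->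
  (0 < eta)%R ->
  exists n1 : nat, forall G : ograph, n1 <= #|G| ->
    ((1 + eta) * #|G|%:R / k%:R <= (min_semidegree G)%:R)%R ->
    forall (C : ograph) (c : 'I_l -> C),
      oriented_cycle c -> cycle_type c = t -> contains G C.
Proof.
move=> k2 tk kmin eta0.
have t1 : 1 < t.
  have : 0 < k ^ 6 by rewrite expn_gt0; lia.
  by move: tk; lia.
have [m freq] := frequent_pattern k2 tk kmin eta0.
have [N blow] := blowup 'I_m (2 * #|{: {ffun 'Z_t -> 'I_m}}|) l.
exists N.+1 => G nN deg C c c_cycle c_type.
have n0 : 0 < #|G| by apply: leq_ltn_trans nN.
have [||W WM] := freq G (@arc G) (@arc_asym G) n0.
- move=> x; apply: le_trans deg _; rewrite ler_nat.
  exact: leq_trans (geq_minl _ _) (bigmin_le _ _ x).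
- move=> x; apply: le_trans deg _; rewrite ler_nat.
  exact: leq_trans (geq_minr _ _) (bigmin_le _ _ x).
have [||S lS SW] := blow G (walk_pattern (@arc G) W); rewrite ?card_ord //.
  exact: ltnW.
have [h hE] := cycle_potential t1 c_cycle c_type.
have [l3 [d cK dK] adj] := c_cycle.
(* Classes may overlap and several cycle vertices may share one, so injectivity has to be
   arranged. *)
have [x x_inj xS] := distinct_representatives (fun i => lS (W (h i))).
have /fin_all_exists[v0 v0S] i : exists y, y \in S i.
  by apply/card_gt0P; apply: leq_trans (lS i); lia.
have pattern_arc v (a : 'Z_t) : (forall i, v i \in S i) -> arc (v (W a)) (v (W (a + 1)%R)).
  move=> vS; have : finfun v \in walk_pattern (@arc G) W.
    by apply: SW => i; rewrite ffunE.
  by rewrite inE => /forallP/(_ a); rewrite !ffunE.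
(* [W a] and [W (a + 1)] differ, since equality would give a loop. Hence [y] and [y'] occur in a
   common tuple, completed by [v0]. *)
have link (a : 'Z_t) y y' : y \in S (W a) -> y' \in S (W (a + 1)%R) -> arc y y'.
  move=> ya ya'.
  have Wa : W a != W (a + 1)%R.
    apply/eqP => Wa; have := pattern_arc _ a v0S; rewrite -Wa => a0.
    by have := arc_asym a0; rewrite a0.
  have := pattern_arc (fun i => if i == W a then y else
                         if i == W (a + 1)%R then y' else v0 i) a.
  rewrite eqxx eq_sym (negPf Wa) eqxx; apply => i.
  by case: eqP => [->//|_]; case: eqP => [->|].
exists (x \o d); split; first exact: inj_comp x_inj (can_inj dK).
move=> y1 y2 y12; have /adj[i [[y1E y2E]|[y1E y2E]]] : adjacent y1 y2.
- by rewrite /adjacent y12.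
- have := hE i; rewrite -y1E -y2E y12 /= y1E y2E !cK => hi.
  by apply: (link (h i)) => //; rewrite -hi.
have := hE i; rewrite -y1E -y2E (negPf (arc_asym y12)) /= y1E y2E !cK => hi.
by apply: (link (h (ordS i))) => //; rewrite -hi.
Qed.

Local Open Scope ring_scope.

Theorem theorem1p5 (R : realType) (k t : nat)
  (hk : (3 <= k)%N)
  (ht : (10 ^ 7 * k ^ 6 <= t)%N)
  (hkt : ~~ (k %| t)%N)
  (hkmin : forall j : nat, (2 < j)%N -> (j < k)%N -> (j %| t)%N) :
  forall (eta : R) (l : nat), 0 < eta ->
  exists n1 : nat,
    forall G : ograph,
      (n1 <= #|G|)%N ->
      (1 + eta) * #|G|%:R / k%:R <= (min_semidegree G)%:R ->
      forall (C : ograph) (c : 'I_l -> C),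
        oriented_cycle c -> cycle_type c = t -> contains G C.
Proof.
move=> eta l eta0; apply: contains_cycle => //.
apply: leq_trans ht; rewrite leq_mul2r; apply/orP; right.
exact: leq_trans (leq_pexp2l (isT : (0 < 10)%N) (isT : (1 <= 7)%N)).
Qed.
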